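(* Let $V$ be a non-zero finite dimensional $\mathbb{F}_q$-vector space. The surjective $\mathbb{F}_q$-algebra homomorphism $A_V/\mathfrak{a}_V \to R_V$ induced by $Y_v\mapsto \frac1v$ for all $v\in V\setminus\{0\}$ is an isomorphism.
   Context: $\mathbb{F}_q$ is a finite field with $q$ elements. Let $S_V$ be the symmetric algebra of $V$ over $\mathbb{F}_q$, $K_V$ its field of quotients, and $R_V\subset K_V$ the $\mathbb{F}_q$-subalgebra generated by $\frac1v$ for all $v\in V\setminus\{0\}$. Let $A_V$ be the polynomial ring over $\mathbb{F}_q$ in the indeterminates $Y_v$ for all $v\in V\setminus\{0\}$, and let $\mathfrak{a}_V\subset A_V$ be the homogeneous ideal generated by all elements $Y_{\alpha v}-\alpha^{-1}Y_v$ for $v\in V\setminus\{0\}$ and $\alpha\in\mathbb{F}_q^\times$, and all elements $Y_vY_{v'}-Y_{v+v'}\cdot(Y_v+Y_{v'})$ for $v,v'\in V\setminus\{0\}$ with $v+v'\neq0$. The ideal $\mathfrak{a}_V$ is contained in the kernel of the surjective homomorphism $A_V\to R_V$, $Y_v\mapsto\frac1v$, because of the identities $\frac1{\alpha v}=\alpha^{-1}\frac1v$ and $\frac1v\cdot\frac1{v'}=\frac1{v+v'}\bigl(\frac1v+\frac1{v'}\bigr)$. *)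

(* Defs.v *)
From HB Require Import structures.
From mathcomp Require Import all_boot all_order all_algebra finmap.
From mathcomp Require Import monalg mpoly.
From mathcomp Require Import boolp.

Set Implicit Arguments.
Unset Strict Implicit.
Unset Printing Implicit Defensive.

Import GRing.Theory.
Local Open Scope ring_scope.
Local Open Scope quotient_scope.

Section SymmetricAlgebra.
Context (F : finFieldType) (V : vectType F).

(* The symmetric algebra of V over F, realised as the polynomial ring in the
   coordinates with respect to [vbasis {:V}]; [symalg_universal] below shows
   that, together with the linear map [sym_in], it has the universal property
   of the symmetric algebra, so that the choice of basis is immaterial. *)
Definition symalg : Type := mpoly (\dim {:V}) F.

HB.instance Definition _ := GRing.ComAlgebra.on symalg.
HB.instance Definition _ := GRing.IntegralDomain.on symalg.

Definition sym_in (v : V) : symalg :=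
  \sum_(i < \dim {:V}) coord (vbasis {:V}) i v *: ('X_i : mpoly _ F).

Fact sym_in_is_linear : linear sym_in.
Proof.
move=> a u v; rewrite /sym_in scaler_sumr -big_split /=.
by apply: eq_bigr => i _; rewrite linearP scalerDl scalerA.
Qed.
HB.instance Definition _ :=
  GRing.isLinear.Build F V symalg _ sym_in sym_in_is_linear.

Lemma sym_in_basis (i : 'I_(\dim {:V})) :
  sym_in (vbasis {:V})`_i = ('X_i : mpoly _ F).
Proof.
rewrite /sym_in (bigD1 i) //= coord_free ?(basis_free (vbasisP _)) // eqxx.
rewrite scale1r big1 ?addr0 // => j ji.
by rewrite coord_free ?(basis_free (vbasisP _)) // eq_sym (negPf ji) scale0r.
Qed.

Lemma sym_in_eq0 (v : V) : (sym_in v == 0) = (v == 0).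
Proof.
apply/eqP/eqP => [sv0|->]; last exact: linear0.
rewrite (coord_vbasis (memvf v)) big1 // => i _.
have := congr1 (fun p : mpoly _ F => p@_(U_(i)%MM)) sv0.
rewrite /sym_in mcoeff0 raddf_sum /= (bigD1 i) //= big1 => [|j ji].
  by rewrite addr0 mcoeffZ mcoeffX eqxx mulr1 => ->; rewrite scale0r.
by rewrite mcoeffZ mcoeffX eq_mnm1 (negPf ji) mulr0.
Qed.

Section Lift.
Context (B : comAlgType F) (f : {linear V -> B}).

Definition sym_lift : symalg -> B :=
  mpoly.mmap (in_alg B) (fun i => f (vbasis {:V})`_i).

HB.instance Definition _ := GRing.RMorphism.copy sym_lift
  (mpoly.mmap (in_alg B) (fun i => f (vbasis {:V})`_i)).

Fact sym_lift_is_scalable : scalable sym_lift.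
Proof. by move=> a p; rewrite /sym_lift mpoly.mmapZ /= mulr_algl. Qed.
HB.instance Definition _ :=
  GRing.isScalable.Build F symalg B _ sym_lift sym_lift_is_scalable.

End Lift.

Lemma symalg_universal (B : comAlgType F) (f : {linear V -> B}) :
  exists g : {lrmorphism symalg -> B},
    (forall v, g (sym_in v) = f v) /\
    (forall g' : {lrmorphism symalg -> B},
       (forall v, g' (sym_in v) = f v) -> g' =1 g).
Proof.
exists (sym_lift f : {lrmorphism _ -> _}).
have liftE v : sym_lift f (sym_in v) = f v.
  rewrite [in RHS](coord_vbasis (memvf v)) !linear_sum /=.
  apply: eq_bigr => i _; rewrite !linearZ /=; congr (_ *: _).
  by rewrite /sym_lift mpoly.mmapX mpoly.mmap1U.
split=> // g' g'E p; rewrite [p]mpoly.mpolyE !linear_sum /=.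
apply: eq_bigr => m _; rewrite !linearZ /=; congr (_ *: _).
rewrite mpoly.mpolyXE_id !rmorph_prod /=; apply: eq_bigr => i _.
by rewrite !rmorphXn /= -sym_in_basis g'E liftE.
Qed.

End SymmetricAlgebra.

Section Generated.
Context (F : fieldType).

Definition ideal_closed (A : comAlgType F) (I : {pred A}) : Prop :=
  0 \in I /\ forall a, {in I &, forall u v, a * u + v \in I}.

Definition gen_ideal (A : comAlgType F) (G : A -> Prop) : {pred A} :=
  fun x => `[< forall I : {pred A},
    ideal_closed I -> (forall g, G g -> g \in I) -> x \in I >].

Definition gen_subalg (A : comAlgType F) (G : A -> Prop) : {pred A} :=
  fun x => `[< forall S : {pred A},
    GRing.subalg_closed S -> (forall g, G g -> g \in S) -> x \in S >].

Lemma gen_ideal_closed (A : comAlgType F) (G : A -> Prop) :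
  ideal_closed (gen_ideal G).
Proof.
split=> [|a u v /asboolP uI /asboolP vI]; apply/asboolP => I IC GI.
  by case: IC.
by case: (IC) => _; apply; [apply: uI | apply: vI].
Qed.

Lemma mem_gen_ideal (A : comAlgType F) (G : A -> Prop) g :
  G g -> g \in gen_ideal G.
Proof. by move=> Gg; apply/asboolP => I _; apply. Qed.

Lemma gen_ideal_min (A : comAlgType F) (G : A -> Prop) (I : {pred A}) :
  ideal_closed I -> (forall g, G g -> g \in I) -> {subset gen_ideal G <= I}.
Proof. by move=> IC GI x /asboolP; apply. Qed.

Lemma gen_ideal_ker (A B : comAlgType F) (h : {rmorphism A -> B})
    (G : A -> Prop) p :
  (forall g, G g -> h g = 0) -> p \in gen_ideal G -> h p = 0.
Proof.
move=> hG pG; apply/eqP; move: p pG.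
apply: (gen_ideal_min (I := [pred p | h p == 0])) => [|g /hG];
  last by move=> /eqP.
split=> [|a u v]; rewrite !inE ?rmorph0 // => /eqP u0 /eqP v0.
by rewrite rmorphD rmorphM u0 v0 mulr0 addr0.
Qed.

Fact gen_subalg_closed (A : comAlgType F) (G : A -> Prop) :
  GRing.subalg_closed (gen_subalg G).
Proof.
split=> [|a u v /asboolP uS /asboolP vS|u v /asboolP uS /asboolP vS];
  apply/asboolP => S SC GS; case: (SC) => S1 SL SM //.
  by apply: SL; [apply: uS | apply: vS].
by apply: SM; [apply: uS | apply: vS].
Qed.

HB.instance Definition _ (A : comAlgType F) (G : A -> Prop) :=
  GRing.isSubalgClosed.Build F A (gen_subalg G) (gen_subalg_closed G).

Lemma mem_gen_subalg (A : comAlgType F) (G : A -> Prop) g :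
  G g -> g \in gen_subalg G.
Proof. by move=> Gg; apply/asboolP => S _; apply. Qed.

End Generated.

Section QuotientAlgebra.
Context (F : fieldType) (A : comAlgType F) (I : idealr A).

(* A / I, with the F-algebra structure for which the projection is linear *)
Definition quotalg : Type := {ideal_quot I}.
HB.instance Definition _ := GRing.ComNzRing.on quotalg.

Definition quotpi : A -> quotalg := \pi_{ideal_quot I}.
HB.instance Definition _ := GRing.RMorphism.copy quotpi \pi_{ideal_quot I}.

Definition quotalg_scale (a : F) (x : quotalg) : quotalg := quotpi a%:A * x.

Fact quotalg_scaleA a b x :
  quotalg_scale a (quotalg_scale b x) = quotalg_scale (a * b) x.
Proof. by rewrite /quotalg_scale mulrA -rmorphM -scalerAl mul1r scalerA. Qed.
Fact quotalg_scale1 : left_id 1 quotalg_scale.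
Proof. by move=> x; rewrite /quotalg_scale scale1r rmorph1 mul1r. Qed.
Fact quotalg_scaleDr : right_distributive quotalg_scale +%R.
Proof. by move=> a x y; rewrite /quotalg_scale mulrDr. Qed.
Fact quotalg_scaleDl x : {morph quotalg_scale^~ x : a b / a + b}.
Proof. by move=> a b; rewrite /quotalg_scale scalerDl rmorphD mulrDl. Qed.
HB.instance Definition _ := GRing.Zmodule_isLmodule.Build F quotalg
  quotalg_scaleA quotalg_scale1 quotalg_scaleDr quotalg_scaleDl.

Fact quotalg_scaleAl (a : F) (x y : quotalg) : a *: (x * y) = (a *: x) * y.
Proof. exact: mulrA. Qed.
HB.instance Definition _ :=
  GRing.Lmodule_isLalgebra.Build F quotalg quotalg_scaleAl.
Fact quotalg_scaleAr (a : F) (x y : quotalg) : a *: (x * y) = x * (a *: y).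
Proof. exact: mulrCA. Qed.
HB.instance Definition _ :=
  GRing.Lalgebra_isAlgebra.Build F quotalg quotalg_scaleAr.

Fact quotpi_is_scalable : scalable quotpi.
Proof. by move=> a p; rewrite -mulr_algl rmorphM. Qed.
HB.instance Definition _ :=
  GRing.isScalable.Build F A quotalg _ quotpi quotpi_is_scalable.

Lemma quotpi_surj (x : quotalg) : exists p, x = quotpi p.
Proof. by exists (repr x); rewrite /quotpi reprK. Qed.

Lemma quotpi_eq0 p : (quotpi p == 0) = (p \in I).
Proof. by rewrite -(rmorph0 quotpi) -Quotient.idealrBE subr0. Qed.

Section Lift.
Context (B : comAlgType F) (h : {lrmorphism A -> B}).
Context (hI : forall p, p \in I -> h p = 0).

(* The homomorphism A / I -> B induced by h, see [quot_liftE] *)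
Definition quot_lift of (forall p, p \in I -> h p = 0) : quotalg -> B :=
  fun x => h (repr x).

Lemma quot_liftE p : quot_lift hI (quotpi p) = h p.
Proof.
apply/eqP; rewrite -subr_eq0 -rmorphB; apply/eqP/hI.
by rewrite Quotient.idealrBE reprK.
Qed.

Fact quot_lift_is_zmod_morphism : zmod_morphism (quot_lift hI).
Proof.
move=> x y; have [p ->] := quotpi_surj x; have [q ->] := quotpi_surj y.
by rewrite -rmorphB !quot_liftE rmorphB.
Qed.
HB.instance Definition _ := GRing.isZmodMorphism.Build quotalg B
  (quot_lift hI) quot_lift_is_zmod_morphism.

Fact quot_lift_is_monoid_morphism : monoid_morphism (quot_lift hI).
Proof.
split=> [|x y]; first by rewrite -(rmorph1 quotpi) quot_liftE rmorph1.
have [p ->] := quotpi_surj x; have [q ->] := quotpi_surj y.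
by rewrite -rmorphM !quot_liftE rmorphM.
Qed.
HB.instance Definition _ := GRing.isMonoidMorphism.Build quotalg B
  (quot_lift hI) quot_lift_is_monoid_morphism.

Fact quot_lift_is_scalable : scalable (quot_lift hI).
Proof.
move=> a x; have [p ->] := quotpi_surj x.
by rewrite -linearZ !quot_liftE linearZ.
Qed.
HB.instance Definition _ := GRing.isScalable.Build F quotalg B _
  (quot_lift hI) quot_lift_is_scalable.

End Lift.
End QuotientAlgebra.

Section PolynomialRing.
Context (F : fieldType) (I : choiceType).

(* The polynomial ring over F in indeterminates indexed by I: the algebra of
   the free commutative monoid on I *)
Definition polyalg : Type := {malg F[{cmonom I}]}.
HB.instance Definition _ := GRing.ComAlgebra.on polyalg.

Section Eval.
Context (B : comAlgType F) (x : I -> B).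

Definition moneval (m : {cmonom I}) : B := \prod_(i <- finsupp m) x i ^+ m i.

Lemma monevalEw (m : {cmonom I}) (d : {fset I}) :
  (finsupp m `<=` d)%fset -> moneval m = \prod_(i <- d) x i ^+ m i.
Proof.
move=> le; rewrite /moneval (big_fset_incl _ le) // => i id.
by move=> /fsfun_dflt ->; rewrite expr0.
Qed.

Fact moneval_mmorphism : mmorphism moneval.
Proof.
split=> [m1 m2|]; last by rewrite /moneval mdom1 big_seq_fset0.
rewrite {1}/moneval mdomD (monevalEw (fsubsetUl _ (finsupp m2))).
rewrite (monevalEw (fsubsetUr (finsupp m1) _)) -big_split /=.
by apply: eq_bigr => i _; rewrite cmM exprD.
Qed.
HB.instance Definition _ := isMultiplicative.Build _ B moneval moneval_mmorphism.

Definition polyeval : polyalg -> B := monalg.mmap (in_alg B) moneval.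
HB.instance Definition _ := GRing.RMorphism.copy polyeval
  (monalg.mmap (in_alg B) moneval).
Fact polyeval_is_scalable : scalable polyeval.
Proof. by move=> a p; rewrite /polyeval monalg.mmapZ /= mulr_algl. Qed.
HB.instance Definition _ :=
  GRing.isScalable.Build F polyalg B _ polyeval polyeval_is_scalable.

End Eval.
End PolynomialRing.

(* The indeterminate of index i; locked because comparing two distinct
   indeterminates by conversion does not terminate in practice. *)
HB.lock Definition polyvar (F : fieldType) (I : choiceType) (i : I) :
  polyalg F I := << ucm i >>.

Lemma polyeval_var (F : fieldType) (I : choiceType) (B : comAlgType F)
  (x : I -> B) i : polyeval x (polyvar F i) = x i.
Proof.
rewrite /polyeval polyvar.unlock monalg.mmapU /= scale1r mul1r /moneval mdomU.
by rewrite big_seq_fset1 cmUU.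
Qed.

Section Rings.
Context (F : finFieldType) (V : vectType F).

Definition nzvec : Type := {v : V | v != 0}.
HB.instance Definition _ := [isSub of nzvec for sval].
HB.instance Definition _ := [Choice of nzvec by <:].

(* K_V: the fraction field of the symmetric algebra, as an F-algebra *)
Definition symfrac : Type := {fraction symalg V}.
HB.instance Definition _ := GRing.Field.on symfrac.

Definition symfrac_scale (a : F) (x : symfrac) : symfrac :=
  tofrac (a%:A : symalg V) * x.

Fact symfrac_scaleA a b x :
  symfrac_scale a (symfrac_scale b x) = symfrac_scale (a * b) x.
Proof.
by rewrite /symfrac_scale mulrA -tofracM -scalerAl mul1r scalerA.
Qed.
Fact symfrac_scale1 : left_id 1 symfrac_scale.
Proof. by move=> x; rewrite /symfrac_scale scale1r tofrac1 mul1r. Qed.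
Fact symfrac_scaleDr : right_distributive symfrac_scale +%R.
Proof. by move=> a x y; rewrite /symfrac_scale mulrDr. Qed.
Fact symfrac_scaleDl x : {morph symfrac_scale^~ x : a b / a + b}.
Proof. by move=> a b; rewrite /symfrac_scale scalerDl tofracD mulrDl. Qed.
HB.instance Definition _ := GRing.Zmodule_isLmodule.Build F symfrac
  symfrac_scaleA symfrac_scale1 symfrac_scaleDr symfrac_scaleDl.

Fact symfrac_scaleAl (a : F) (x y : symfrac) : a *: (x * y) = (a *: x) * y.
Proof. exact: mulrA. Qed.
HB.instance Definition _ :=
  GRing.Lmodule_isLalgebra.Build F symfrac symfrac_scaleAl.
Fact symfrac_scaleAr (a : F) (x y : symfrac) : a *: (x * y) = x * (a *: y).
Proof. exact: mulrCA. Qed.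
HB.instance Definition _ :=
  GRing.Lalgebra_isAlgebra.Build F symfrac symfrac_scaleAr.

(* 1/v in K_V *)
Definition vecinv (v : nzvec) : symfrac := (tofrac (sym_in (val v)))^-1.

(* R_V: the F-subalgebra of K_V generated by the 1/v *)
Definition invalg_pred : {pred symfrac} :=
  gen_subalg (fun x => exists v, x = vecinv v).
HB.instance Definition _ := GRing.SubalgClosed.on invalg_pred.

Definition invalg : Type := {x : symfrac | x \in invalg_pred}.
HB.instance Definition _ := [isSub of invalg for sval].
HB.instance Definition _ := [Choice of invalg by <:].
HB.instance Definition _ := [SubChoice_isSubAlgebra of invalg by <:].
HB.instance Definition _ := [SubNzRing_isSubComNzRing of invalg by <:].

Fact vecinv_in (v : nzvec) : vecinv v \in invalg_pred.
Proof. by apply: mem_gen_subalg; exists v. Qed.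
Definition invalg_gen (v : nzvec) : invalg := exist _ (vecinv v) (vecinv_in v).

(* A_V: the polynomial ring in the indeterminates Y_v, v nonzero *)
Definition Yalg : Type := polyalg F nzvec.
HB.instance Definition _ := GRing.ComAlgebra.on Yalg.

Definition Y (v : nzvec) : Yalg := polyvar F v.

(* In [Yrel_scale] and [Yrel_add], [av] and [vw] stand for the elements
   a *: v and v + w of V, which are nonzero because [av] and [vw] are
   elements of [nzvec]. *)
Inductive Yrel : Yalg -> Prop :=
| Yrel_scale (a : F) (v av : nzvec) of a != 0 & val av = a *: val v :
    Yrel (Y av - a^-1 *: Y v)
| Yrel_add (v w vw : nzvec) of val vw = val v + val w :
    Yrel (Y v * Y w - Y vw * (Y v + Y w)).

(* The ideal a_V of A_V *)
Definition Yideal : {pred Yalg} := gen_ideal Yrel.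

(* The homomorphism A_V -> R_V, Y_v |-> 1/v, see [YevalY] *)
Definition Yeval : Yalg -> invalg := polyeval invalg_gen.
HB.instance Definition _ := GRing.LRMorphism.copy Yeval (polyeval invalg_gen).

Lemma YevalY v : Yeval (Y v) = invalg_gen v.
Proof. exact: polyeval_var. Qed.

Fact vecinvV : exists2 t : nzvec -> symfrac,
  forall v, t v = tofrac (sym_in (val v)) &
  forall v, t v != 0 /\ vecinv v = (t v)^-1.
Proof.
exists (fun v => tofrac (sym_in (val v))) => // v; split=> //.
by rewrite tofrac_eq0 sym_in_eq0 (valP v).
Qed.

Lemma invalg_genZ (a : F) (v av : nzvec) :
  a != 0 -> val av = a *: val v -> invalg_gen av = a^-1 *: invalg_gen v.
Proof.
have [t tE tV] := vecinvV; move=> a0 E.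
have tav : t av = a *: t v.
  by rewrite !tE E linearZ /= -[a *: sym_in _]mulr_algl (rmorphM (@tofrac _)).
apply: val_inj; rewrite linearZ /= (tV v).2 (tV av).2 tav.
by rewrite invrZ // unitfE ?a0 ?(tV v).1.
Qed.

Lemma invalg_genM (v w vw : nzvec) : val vw = val v + val w ->
  invalg_gen v * invalg_gen w = invalg_gen vw * (invalg_gen v + invalg_gen w).
Proof.
have [t tE tV] := vecinvV; move=> E.
have tvw : t vw = t v + t w.
  by rewrite !tE E linearD (rmorphD (@tofrac _)).
apply: val_inj; rewrite !rmorphM rmorphD /= (tV v).2 (tV w).2 (tV vw).2.
have -> : (t v)^-1 + (t w)^-1 = t vw * ((t v)^-1 * (t w)^-1).
  by rewrite tvw mulrDl mulVKf ?(tV v).1 // mulrCA mulfV ?(tV w).1 // mulr1 addrC.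
by rewrite mulKf ?(tV vw).1.
Qed.

Lemma Yeval_rel p : Yrel p -> Yeval p = 0.
Proof.
case=> [a v av a0 E|v w vw E].
  by rewrite linearB linearZ /= 2!YevalY (invalg_genZ a0 E) subrr.
have relE (A B : comAlgType F) (h : {rmorphism A -> B}) x y z :
    h (x * y - z * (x + y)) = h x * h y - h z * (h x + h y).
  by rewrite rmorphB !rmorphM rmorphD.
by rewrite relE /= !YevalY (invalg_genM E) subrr.
Qed.

Lemma Yeval_ideal p : p \in Yideal -> Yeval p = 0.
Proof. exact: (gen_ideal_ker (h := Yeval) Yeval_rel). Qed.

Fact Yideal_closed : idealr_closed Yideal.
Proof.
have [I0 Ilin] := gen_ideal_closed Yrel; split=> //.
apply/negP => /Yeval_ideal /eqP.
by rewrite (rmorph1 Yeval) oner_eq0.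
Qed.
HB.instance Definition _ := isIdealr.Build Yalg Yideal Yideal_closed.

(* The induced homomorphism A_V / a_V -> R_V, see [Ymap_Y] *)
Definition Ymap : quotalg Yideal -> invalg := quot_lift Yeval_ideal.
HB.instance Definition _ := GRing.LRMorphism.copy Ymap (quot_lift Yeval_ideal).

Lemma Ymap_Y v : Ymap (quotpi Yideal (Y v)) = invalg_gen v.
Proof. exact: etrans (quot_liftE Yeval_ideal _) (YevalY v). Qed.

End Rings.

Arguments Yideal {F} V _.
Arguments Yeval {F} V _.
Arguments Ymap {F} V _.

(* Main.v *)
Require Import Defs.
From HB Require Import structures.
From mathcomp Require Import all_boot all_order all_algebra finfield.
From mathcomp Require Import finmap monalg mpoly.
From mathcomp Require Import boolp.

(** Write e_0, ..., e_(n-1) for a basis of V, V_k for the span of the first k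
    basis vectors, and y_v for the class of Y_v in A_V / a_V, with y_0 = 0.
    Surjectivity holds because R_V is generated by the 1/v.  Injectivity is
    proved by induction on k, on the subalgebra Q_k of A_V / a_V generated by
    the y_v with v in V_k; for k = n this subalgebra is everything.

    Straightening.  If u and v are distinct in V_k, the defining relation for
    (v - u) + (e_k + u) = e_k + v reads
      y_(e_k+v) y_(e_k+u) = y_(v-u) (y_(e_k+u) - y_(e_k+v)),
    where y_(v-u) lies in Q_k.  So a product of generators attached to two
    different translates of e_k can be traded for Q_k-combinations of shorter
    products, and every element of Q_(k+1) is a sum, over u in V_k, of
    polynomials in the single element y_(e_k+u) with coefficients in Q_k
    ([level_nf]).

    Independence.  The image of such a sum in K_V is a sum of polynomials in
    1/(X_k + u) whose coefficients and poles do not involve the variable X_k.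
    By uniqueness of partial fraction decompositions
    ([partial_fractions_free]) the sum can vanish only if all coefficients of
    positive degree have image zero.  By the induction hypothesis these
    coefficients are zero already in Q_k, so the given element of Q_(k+1)
    lies in Q_k, where the induction hypothesis applies a second time
    ([level_inj_step]).

    That X_k is a free variable over the field generated by the other
    variables is expressed by a ring homomorphism Phi from K_V to an extension
    of the rational function field K_V(T): it sends X_k to T and fixes
    everything that does not involve X_k ([generic_var_lift]). *)

Set Implicit Arguments.
Unset Strict Implicit.
Unset Printing Implicit Defensive.

Import GRing.Theory.
Local Open Scope ring_scope.

(** * Generated subalgebras *)

Lemma gen_subalg_min (F : fieldType) (A : comAlgType F) (G : A -> Prop)
    (S : {pred A}) :
  GRing.subalg_closed S -> (forall g, G g -> g \in S) ->
  {subset gen_subalg G <= S}.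
Proof. by move=> SC GS x /asboolP; apply. Qed.

(** The locus where two ring homomorphisms agree is a subring, and it is a
    subalgebra as soon as it contains the scalars. *)
Lemma gen_subalg_equalizer (F : fieldType) (A : comAlgType F) (K L : nzRingType)
    (psi : {rmorphism A -> K}) (f g : {rmorphism K -> L}) (G : A -> Prop) :
  (forall c : F, f (psi c%:A) = g (psi c%:A)) ->
  (forall x, G x -> f (psi x) = g (psi x)) ->
  {in gen_subalg G, forall x, f (psi x) = g (psi x)}.
Proof.
move=> fgC fgG x xG; apply/eqP.
apply: (gen_subalg_min (S := [pred x | f (psi x) == g (psi x)])) xG => [|z].
  split=> [|c u v /eqP fu /eqP fv|u v /eqP fu /eqP fv]; apply/eqP.
  - by rewrite !rmorph1.
  - by rewrite -[c *: u]mulr_algl !rmorphD !rmorphM /= fgC fu fv.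
  - by rewrite !rmorphM /= fu fv.
by move=> /fgG/eqP.
Qed.

(** Each monomial other than 1 splits off an indeterminate, so that induction
    on the degree puts all monomials, hence all polynomials, into S. *)
Lemma polyalg_gen (F : fieldType) (I : choiceType) (S : {pred polyalg F I}) :
  GRing.subalg_closed S -> (forall i, polyvar F i \in S) -> forall p, p \in S.
Proof.
move=> [S1 SL SM] Svar.
have S0 : 0 \in S by rewrite -(addNr (1 : polyalg F I)) -scaleN1r; apply: SL.
have mon d (m : {cmonom I}) :
    monalg.mdeg m = d -> (<< m >> : polyalg F I) \in S.
  elim: d m => [|d IH] m md.
    have -> : m = mone by apply/eqP; rewrite -monalg.mdeg_eq0 md.
    exact: S1.
  have [i im] : exists i, i \in finsupp m.
    apply/fset0Pn; apply/eqP => m0.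
    by move: md; rewrite monalg.mdegE m0 big_seq_fset0.
  have mE : m = mmul (ucm i) (divcm m (ucm i)).
    apply/eqP/cmP => j; rewrite cmM divcmE cmU.
    case: eqP => [<-|_]; last by rewrite subn0.
    by rewrite subnKC // lt0n cmE_neq0.
  have -> : (<< m >> : polyalg F I) = polyvar F i * << divcm m (ucm i) >>.
    by rewrite polyvar.unlock [in LHS]mE malgM_def fgmulUU mulr1.
  apply: SM (Svar i) _; apply: IH; move: md.
  by rewrite [in X in X -> _]mE monalg.mdegM monalg.mdegU => -[].
move=> p; rewrite [p]monalgE; elim/big_rec: _ => [//|m x _ xS].
rewrite -[monalg.mcoeff m p]mulr1 -[m in << _ *g m >>]mul1m.
rewrite -fgmulUU -malgM_def mul_malgC.
exact: (SL (monalg.mcoeff m p) << m >> x (mon _ m erefl) xS).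
Qed.

(** * Partial fractions *)

(** Multiplying by the product of all T_w ^ N_w, where T_w = 'X + f w and N_w
    is the degree of P_w, turns the equation into an identity between
    polynomials.  If some P_u had positive degree, evaluating that identity at
    the root - f u of T_u would leave only the term of u, and in it only the
    leading coefficient of P_u times a product of nonzero differences. *)
Lemma partial_fractions_free (K L : fieldType) (h : {rmorphism {poly K} -> L})
    (U : finType) (W : pred U) (f : U -> K) (P : U -> {poly K}) :
  injective h -> injective f ->
  \sum_(u | W u) (map_poly (h \o polyC) (P u)).[(h ('X + (f u)%:P))^-1] = 0 ->
  forall u, W u -> (size (P u) <= 1)%N.
Proof.
move=> h_inj f_inj sum0 u Wu; rewrite leqNgt; apply/negP => size_gt1.
have h_eq0 p : (h p == 0) = (p == 0) by rewrite -(rmorph0 h) (inj_eq h_inj).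
pose T w := 'X + (f w)%:P; pose N w := (size (P w)).-1.
(* rev w is T_w ^ N_w times P_w evaluated at the inverse of T_w *)
pose rev w := \sum_(i < size (P w)) (P w)`_i *: T w ^+ (N w - i).
have T0 w : h (T w) != 0.
  by rewrite h_eq0 -size_poly_eq0 size_XaddC.
have revE w : h (rev w) =
    h (T w) ^+ N w * (map_poly (h \o polyC) (P w)).[(h (T w))^-1].
  rewrite horner_coef size_map_poly /rev rmorph_sum mulr_sumr.
  apply: eq_bigr => i _.
  rewrite coef_map /= -mul_polyC rmorphM rmorphXn /= mulrCA; congr (_ * _).
  have le_iN : (i <= N w)%N by rewrite /N -ltnS (ltn_predK (ltn_ord i)).
  rewrite -[in RHS](subnK le_iN) exprD exprVn mulfK //.
  exact: expf_neq0 (T0 w).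
have sum0' :
    \sum_(w | W w) rev w * \prod_(w' | W w' && (w' != w)) T w' ^+ N w' = 0.
  apply/eqP; rewrite -h_eq0 rmorph_sum /=.
  have := congr1 ( *%R (\prod_(w | W w) h (T w) ^+ N w)) sum0.
  rewrite mulr0 mulr_sumr => sumE; apply/eqP; rewrite -[RHS]sumE.
  apply: eq_bigr => w Ww.
  rewrite rmorphM /= revE rmorph_prod /= [in RHS](bigD1 w) //=.
  rewrite mulrAC; congr (_ * _ * _).
  by apply: eq_bigr => w' _; rewrite rmorphXn.
have Tu w : (T w).[- f u] = f w - f u by rewrite !hornerE addrC.
have /(congr1 (fun p => p.[- f u])) := sum0'.
rewrite horner0 horner_sum (bigD1 u) //= [X in _ + X]big1; last first.
  move=> w /andP[Ww wu]; rewrite hornerM horner_prod (bigD1 u) /=; last first.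
    by rewrite Wu eq_sym.
  rewrite horner_exp Tu subrr expr0n /N.
  by case: (size _) size_gt1 => [|[|n]] // _; rewrite mul0r mulr0.
rewrite addr0 hornerM => /eqP; rewrite mulf_eq0 => /orP[|].
  rewrite /rev horner_sum -(ltn_predK size_gt1) big_ord_recr /= big1.
    rewrite add0r hornerZ subnn expr0 hornerE mulr1 -/(lead_coef _).
    by rewrite lead_coef_eq0 -size_poly_eq0; case: (size _) size_gt1.
  move=> i _; rewrite hornerZ horner_exp Tu subrr expr0n subn_eq0.
  by rewrite /N leqNgt ltn_ord mulr0.
rewrite horner_prod => /prodf_eq0 [w /andP[_ wu]].
by rewrite horner_exp Tu expf_eq0 subr_eq0 (inj_eq f_inj) (negPf wu) andbF.
Qed.

(** The form in which independence is used: the sum lives in an algebra A over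
    which nothing is known, and x plays the role of a free variable in K, as
    witnessed by [Phi], which sends x to the variable of {poly K} and fixes the
    poles and the coefficients. *)
Lemma partial_fractions_coef0 (A : comNzRingType) (K L : fieldType)
    (psi : {rmorphism A -> K}) (h : {rmorphism {poly K} -> L})
    (Phi : {rmorphism K -> L}) (U : finType) (W : pred U)
    (x : K) (f : U -> K) (y : U -> A) (P : U -> {poly A}) :
    injective h -> injective f -> Phi x = h 'X ->
    (forall u, W u -> Phi (f u) = h (f u)%:P) ->
    (forall u, W u -> psi (y u) = (x + f u)^-1) ->
    (forall u i, W u -> Phi (psi (P u)`_i) = h (psi (P u)`_i)%:P) ->
    psi (\sum_(u | W u) (P u).[y u]) = 0 ->
  forall u i, W u -> (0 < i)%N -> psi (P u)`_i = 0.
Proof.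
move=> h_inj f_inj PhiX Phif psi_yE PhiP sum0 u i Wu i0.
pose Q u := map_poly psi (P u).
have Qsum0 : \sum_(u | W u)
    (map_poly (h \o polyC) (Q u)).[(h ('X + (f u)%:P))^-1] = 0.
  have := congr1 Phi sum0; rewrite rmorph0 !rmorph_sum /= => sum0'.
  rewrite -[RHS]sum0'; apply: eq_bigr => v Wv.
  rewrite -horner_map -horner_map /= psi_yE // fmorphV.
  rewrite (rmorphD Phi) PhiX Phif // -rmorphD; congr (_.[_]).
  by apply/polyP => j; rewrite !coef_map /= PhiP.
have /leq_sizeP/(_ i i0) := partial_fractions_free h_inj f_inj Qsum0 Wu.
by rewrite coef_map.
Qed.

(** * Homomorphisms out of a field of fractions *)

Lemma fraction_numden (R : idomainType) (x : {fraction R}) :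
  x = tofrac (repr x).1 / tofrac (repr x).2.
Proof.
have d0 := denom_ratioP (repr x).
have tf_d0 : tofrac (repr x).2 != 0 by rewrite tofrac_eq0.
apply: (mulIf tf_d0); rewrite mulfVK //.
move: (repr x) (reprK x) d0 => r <- d0 {tf_d0}; unlock tofrac.
rewrite -[LHS]FracField.pi_mul; apply/eqmodP => /=.
rewrite /FracField.mulf FracField.equivfE.
by rewrite !numden_Ratio ?mulr1 ?oner_eq0 // mulrC.
Qed.

Section FractionLift.
Context (R : idomainType) (K : fieldType) (t : {rmorphism R -> K}).
Context (t_inj : injective t).
(* K is a field of fractions of R, with t as the canonical embedding. *)
Context (tP : forall x, exists n d, d != 0 /\ x = t n / t d).

Lemma fraction_lift (L : fieldType) (g : {rmorphism R -> L}) :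
  injective g -> exists h : {rmorphism K -> L}, forall a, h (t a) = g a.
Proof.
move=> g_inj.
have t_eq0 a : (t a == 0) = (a == 0) by rewrite -(rmorph0 t) (inj_eq t_inj).
have g_eq0 a : (g a == 0) = (a == 0) by rewrite -(rmorph0 g) (inj_eq g_inj).
have /boolp.choice [nd ndP] x : exists nd : R * R,
    nd.2 != 0 /\ x = t nd.1 / t nd.2.
  by have [n [d nd]] := tP x; exists (n, d).
pose h x := g (nd x).1 / g (nd x).2.
have hE n d : d != 0 -> h (t n / t d) = g n / g d.
  move=> d0; have [e0 /eqP] := ndP (t n / t d); rewrite /h.
  rewrite eqr_div ?t_eq0 // -!rmorphM (inj_eq t_inj) => /eqP nd_eq.
  by apply/eqP; rewrite eqr_div ?g_eq0 // -!rmorphM nd_eq.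
have h_zmod : zmod_morphism h.
  move=> x y; have [n [d [d0 ->]]] := tP x; have [m [e [e0 ->]]] := tP y.
  have -> : t n / t d - t m / t e = t (n * e - m * d) / t (d * e).
    by rewrite -mulNr addf_div ?t_eq0 // mulNr rmorphB !rmorphM.
  rewrite !hE ?mulf_neq0 // rmorphB !rmorphM -[X in _ = _ + X]mulNr.
  by rewrite addf_div ?g_eq0 // mulNr.
have h_mon : monoid_morphism h.
  split=> [|x y].
    have -> : 1 = t 1 / t 1 by rewrite rmorph1 divr1.
    by rewrite hE ?oner_eq0 // rmorph1 divr1.
  have [n [d [d0 ->]]] := tP x; have [m [e [e0 ->]]] := tP y.
  by rewrite mulf_div -!rmorphM !hE ?mulf_neq0 // !rmorphM mulf_div.
pose hZ := GRing.isZmodMorphism.Build _ _ h h_zmod.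
pose hM := GRing.isMonoidMorphism.Build _ _ h h_mon.
exists (HB.pack h hZ hM : {rmorphism K -> L}) => a /=.
have -> : t a = t a / t 1 by rewrite rmorph1 divr1.
by rewrite hE ?oner_eq0 // rmorph1 divr1.
Qed.

(** The homomorphism [phi] is meant to rewrite an element of R as a polynomial
    in the variable x.  Since evaluation at x inverts it, it is injective and
    extends to K; the target [L] is an extension of the rational function field
    over K, in which [h] embeds the polynomials. *)
Lemma fraction_poly_lift (phi : {rmorphism R -> {poly R}}) x :
    (forall p, (phi p).[x] = p) ->
  exists (L : fieldType) (h : {rmorphism {poly K} -> L})
    (Phi : {rmorphism K -> L}),
    injective h /\ forall a, Phi (t a) = h (map_poly t (phi a)).
Proof.
move=> phi_x.
pose h : {rmorphism {poly K} -> {fraction {poly K}}} :=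
  @tofrac ({poly K} : idomainType).
have h_inj : injective h by move=> p q /eqP; rewrite tofrac_eq => /eqP.
pose mp : {rmorphism {poly R} -> {poly K}} := map_poly t.
pose g : {rmorphism R -> {fraction {poly K}}} := h \o (mp \o phi).
have g_inj : injective g.
  move=> p q /h_inj /(congr1 (fun P => P.[t x])).
  by rewrite /= !horner_map /= !phi_x => /t_inj.
have [Phi PhiE] := fraction_lift g_inj.
by exists {fraction {poly K}}, h, Phi.
Qed.

End FractionLift.

(** * Splitting off one variable *)

Section SplitVariable.
Context (R : idomainType) (n : nat) (k : 'I_n).
Local Notation S := {mpoly R[n]}.

(** A polynomial in n variables, as a polynomial in the k-th variable whose
    coefficients do not involve that variable.  The coefficients stay in
    the ring of all n variables, so that evaluation at the k-th variable makes
    sense and recovers the polynomial. *)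
Definition split_var : S -> {poly S} :=
  mpoly.mmap (polyC \o @mpolyC n R) (fun i => if i == k then 'X else ('X_i)%:P).
HB.instance Definition _ := GRing.RMorphism.copy split_var
  (mpoly.mmap (polyC \o @mpolyC n R)
     (fun i => if i == k then 'X else ('X_i)%:P)).

Lemma split_varC c : split_var c%:MP = (c%:MP)%:P.
Proof. by rewrite /split_var mpoly.mmapC. Qed.

Lemma split_varX i : split_var 'X_i = if i == k then 'X else ('X_i)%:P.
Proof. by rewrite /split_var mpoly.mmapX mpoly.mmap1U. Qed.

Lemma split_var_horner p : (split_var p).['X_k] = p.
Proof.
rewrite [in RHS](mpolyE p) /split_var /mpoly.mmap horner_sum.
apply: eq_bigr => m _.
rewrite hornerM /= hornerC -mul_mpolyC.
congr (_ * _); rewrite [RHS]mpolyXE_id /mpoly.mmap1 horner_prod.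
apply: eq_bigr => i _; rewrite horner_exp.
by case: eqP => [->|_]; rewrite ?hornerX ?hornerC.
Qed.
End SplitVariable.

(** * Linear forms in the field of fractions of the symmetric algebra *)

Section LinearForms.
Context (F : finFieldType) (V : vectType F).
Local Notation K := (symfrac V).
Local Notation n := (\dim {:V}).

(** [tofrac], as a ring homomorphism for the structures attached to [symalg]
    and [symfrac] *)
Definition symfrac_in : symalg V -> K := @tofrac (symalg V).
HB.instance Definition _ :=
  GRing.RMorphism.copy symfrac_in (@tofrac (symalg V)).

Lemma symfrac_in_inj : injective symfrac_in.
Proof. by move=> p q /eqP; rewrite tofrac_eq => /eqP. Qed.

Lemma symfrac_inP (x : K) :
  exists a b, b != 0 /\ x = symfrac_in a / symfrac_in b.
Proof.
exists (repr (x : {fraction symalg V})).1, (repr (x : {fraction symalg V})).2.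
by split; [exact: denom_ratioP | exact: fraction_numden].
Qed.

Lemma symfrac_in_alg a : symfrac_in (a%:MP : mpoly n F) = a%:A.
Proof.
by rewrite /GRing.scale /= /symfrac_scale mulr1 -mul_mpolyC mulr1.
Qed.

Definition linform (v : V) : K := symfrac_in (sym_in v).

Fact linform_is_linear : linear linform.
Proof.
move=> a u v; rewrite /linform linearP /= -[a *: sym_in u]mulr_algl.
by rewrite rmorphD rmorphM.
Qed.
HB.instance Definition _ :=
  GRing.isLinear.Build F V K _ linform linform_is_linear.

Lemma linform_eq0 v : (linform v == 0) = (v == 0).
Proof. by rewrite tofrac_eq0 sym_in_eq0. Qed.

Lemma linform_inj : injective linform.
Proof.
move=> u v uv; apply/eqP; rewrite -subr_eq0 -linform_eq0 linearB /=.
by rewrite uv subrr.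
Qed.

Definition split_sym k : symalg V -> {poly symalg V} := split_var k.
HB.instance Definition _ k := GRing.RMorphism.copy (split_sym k) (split_var k).

Lemma split_sym_horner k (p : symalg V) :
  (split_sym k p).[('X_k : mpoly n F)] = p.
Proof. exact: split_var_horner. Qed.

Lemma split_symC k c : split_sym k (c%:MP : mpoly n F) = (c%:MP : mpoly n F)%:P.
Proof. exact: split_varC. Qed.

Lemma split_symX k i :
  split_sym k ('X_i : mpoly n F) = if i == k then 'X else ('X_i : mpoly n F)%:P.
Proof. exact: split_varX. Qed.

Lemma split_sym_in k v : coord (vbasis {:V}) k v = 0 ->
  split_sym k (sym_in v) = (sym_in v)%:P.
Proof.
move=> vk0; rewrite /sym_in !rmorph_sum /=; apply: eq_bigr => i _.
have [->|ik] := eqVneq i k; first by rewrite vk0 !scale0r !rmorph0.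
by rewrite -mul_mpolyC !rmorphM /= split_symC split_symX (negPf ik).
Qed.

(** The k-th basis vector is a free variable over all linear forms without
    k-th coordinate: [Phi] sends it to the variable of {poly K}, and fixes those
    linear forms and the scalars.  A polynomial relation over the field they
    generate therefore becomes an identity between polynomials. *)
Lemma generic_var_lift (k : 'I_n) :
  exists (L : fieldType) (h : {rmorphism {poly K} -> L})
    (Phi : {rmorphism K -> L}),
  [/\ injective h, Phi (linform (vbasis {:V})`_k) = h 'X,
      forall v, coord (vbasis {:V}) k v = 0 ->
        Phi (linform v) = h (linform v)%:P
    & forall a : F, Phi a%:A = h (a%:A)%:P].
Proof.
have [L [h [Phi [h_inj PhiE]]]] :=
  fraction_poly_lift symfrac_in_inj symfrac_inP (split_sym_horner k).
exists L, h, Phi; split=> // [|v vk0|a].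
- by rewrite PhiE /= sym_in_basis split_symX eqxx map_polyX.
- by rewrite PhiE /= split_sym_in // map_polyC.
- by rewrite -symfrac_in_alg PhiE /= split_symC map_polyC.
Qed.
End LinearForms.

(** * The flag of coordinate subspaces *)

Section Flag.
Context (F : finFieldType) (V : vectType F).
Local Notation n := (\dim {:V}).
Local Notation e k := ((vbasis {:V})`_k).

Definition flag (k : nat) : {pred V} :=
  fun v => [forall i : 'I_n, (k <= i)%N ==> (coord (vbasis {:V}) i v == 0)].

Lemma flagP k v :
  reflect (forall i : 'I_n, (k <= i)%N -> coord (vbasis {:V}) i v = 0)
          (v \in flag k).
Proof.
apply: (iffP forallP) => fv i; first by move/implyP: (fv i) => /[apply] /eqP.
by apply/implyP => /fv ->.
Qed.

Fact flag_submod_closed k : GRing.submod_closed (flag k).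
Proof.
split=> [|a u v /flagP uk /flagP vk]; apply/flagP => i ki.
  by rewrite linear0.
by rewrite linearP /= uk // vk // mulr0 addr0.
Qed.
HB.instance Definition _ k :=
  GRing.isSubmodClosed.Build F V (flag k) (flag_submod_closed k).

Lemma flag0 v : v \in flag 0 -> v = 0.
Proof.
move=> /flagP v0; rewrite (coord_vbasis (memvf v)) big1 // => i _.
by rewrite v0 // scale0r.
Qed.

Lemma flag_full v : v \in flag n.
Proof. by apply/flagP => i; rewrite leqNgt ltn_ord. Qed.

Lemma coord_vbasisE (i j : 'I_n) :
  coord (vbasis {:V}) i (e j) = (i == j :> nat)%:R.
Proof. by rewrite coord_free ?(basis_free (vbasisP _)) // eq_sym. Qed.

Lemma flagS (k : 'I_n) v : v \in flag k.+1 ->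
  v - coord (vbasis {:V}) k v *: e k \in flag k.
Proof.
move=> /flagP vk; apply/flagP => i; rewrite leq_eqVlt => /predU1P[ki|ki].
  have -> : i = k by apply: val_inj.
  by rewrite linearB linearZ /= coord_vbasisE eqxx mulr1 subrr.
rewrite linearB linearZ /= coord_vbasisE vk // gtn_eqF //.
by rewrite mulr0 subrr.
Qed.

Lemma flag_coord (k : 'I_n) v : v \in flag k -> coord (vbasis {:V}) k v = 0.
Proof. by move=> /flagP; apply. Qed.

Lemma basis_flag_neq0 (k : 'I_n) u : u \in flag k -> e k + u != 0.
Proof.
move=> uk; apply/eqP => /(congr1 (coord (vbasis {:V}) k)).
rewrite linearD linear0 /= coord_vbasisE eqxx flag_coord // addr0 => /eqP.
by rewrite oner_eq0.
Qed.
End Flag.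

(** * Straightening and induction along the flag *)

Section NormalForm.
Context (F : finFieldType) (V : vectType F) (A : comAlgType F).
Context (psi : {lrmorphism A -> symfrac V}) (y : V -> A).
(* As inversion maps 0 to 0, the case a = 0 of the first relation says that
   y 0 = 0, and the last one then holds for v = 0 too. *)
Context (yZ : forall a v, y (a *: v) = a^-1 *: y v).
Context (yM : forall v w, v != 0 -> w != 0 -> v + w != 0 ->
  y v * y w = y (v + w) * (y v + y w)).
Context (psi_y : forall v, psi (y v) = (linform v)^-1).
Local Notation n := (\dim {:V}).
Local Notation e k := ((vbasis {:V})`_k).

(** Q_k in the introduction *)
Definition level k : {pred A} :=
  gen_subalg (fun x => exists2 v, v \in flag k & x = y v).
HB.instance Definition _ k := GRing.SubalgClosed.on (level k).

Lemma y_level k v : v \in flag k -> y v \in level k.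
Proof. by move=> vk; apply: mem_gen_subalg; exists v. Qed.

(** The constant terms of the P u are not normalised: all of them lie in
    [level k], and only their sum matters. *)
Definition normal_form (k : 'I_n) (x : A) : Prop :=
  exists2 P : finvect_type V -> {poly A},
    forall u : finvect_type V, P u \is a polyOver (level k)
  & x = \sum_(u : finvect_type V | (u : V) \in flag k) (P u).[y (e k + u)].

Section Level.
Context (k : 'I_n).
Local Notation nf := (normal_form k).
Local Notation yk u := (y (e k + u)).

Lemma nf_monomial a u i : a \in level k -> u \in flag k -> nf (a * yk u ^+ i).
Proof.
move=> ak uk; exists (fun w => if w == u then a *: 'X^i else 0) => [w|].
  by case: ifP => _; rewrite ?rpred0 // polyOverZ // polyOverXn.
rewrite (bigD1 (u : finvect_type V)) //= eqxx hornerZ hornerXn big1 ?addr0 //.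
by move=> w /andP[_ /negPf->]; rewrite horner0.
Qed.

Lemma nf0 : nf 0.
Proof.
exists (fun=> 0) => [u|]; first exact: rpred0.
by rewrite big1 // => u _; rewrite horner0.
Qed.

Lemma nf_linear a x z : a \in level k -> nf x -> nf z -> nf (a * x + z).
Proof.
move=> ak [P Pk ->] [Q Qk ->]; exists (fun u => a *: P u + Q u) => [u|].
  by rewrite rpredD // polyOverZ.
rewrite mulr_sumr -big_split /=; apply: eq_bigr => u _.
by rewrite hornerD hornerZ.
Qed.

Lemma nfM a x : a \in level k -> nf x -> nf (a * x).
Proof. by move=> ak xk; rewrite -[a * x]addr0; apply: nf_linear nf0. Qed.

Lemma nfD x z : nf x -> nf z -> nf (x + z).
Proof. by move=> xk zk; rewrite -[x]mul1r; apply: nf_linear (rpred1 _) _ _. Qed.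

(** The straightening step: for v != u the defining relation replaces the
    product of y_(e_k+v) and y_(e_k+u) by a combination of the two factors,
    which lowers the exponent i. *)
Lemma nf_mul_monomial v u i : v \in flag k -> u \in flag k ->
  nf (yk v * yk u ^+ i).
Proof.
move=> vk uk; have [->|uv] := eqVneq v u.
  by rewrite -exprS -[_ ^+ _]mul1r; apply: nf_monomial (rpred1 _) _.
have tk : y (v - u) \in level k by rewrite y_level // rpredB.
have vE : v - u + (e k + u) = e k + v by rewrite addrCA subrK.
have rel : yk v * yk u = y (v - u) * yk u - y (v - u) * yk v.
  have vu0 : v - u != 0 by rewrite subr_eq0.
  rewrite (yM vu0) ?vE ?basis_flag_neq0 //.
  by rewrite mulrDr [_ * yk v]mulrC [yk v * y _ + _]addrC addrK.
elim: i => [|i IH].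
  by rewrite mulr1 -[yk v]mul1r -[yk v]expr1; apply: nf_monomial (rpred1 _) _.
rewrite exprS mulrA rel mulrBl -!mulrA -exprS -mulNr addrC.
by apply: nf_linear; rewrite ?rpredN //; apply: nf_monomial.
Qed.

(** Either v lies in V_k, or it is a nonzero multiple of some e_k + w with w in
    V_k, in which case y_v is a multiple of y_(e_k+w). *)
Lemma nf_mul_gen v x : v \in flag k.+1 -> nf x -> nf (y v * x).
Proof.
move=> /flagS; set c := coord _ _ _ => uk.
have vE : v = c *: e k + (v - c *: e k) by rewrite addrC subrK.
move=> [P Pk ->]; have [c0|c0] := eqVneq c 0.
  apply: nfM; last by exists P.
  by apply: y_level; move: uk; rewrite c0 scale0r subr0.
have -> : y v = c^-1 *: yk (c^-1 *: (v - c *: e k)).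
  by rewrite -yZ scalerDr scalerA divff // scale1r -vE.
rewrite mulr_sumr; apply: big_ind => [|//|u u_k]; [exact: nf0 | exact: nfD|].
rewrite horner_coef mulr_sumr; apply: big_ind => [|//|i _].
- exact: nf0.
- exact: nfD.
rewrite -scalerAl mulrCA -mulr_algl; apply: nfM; first exact: rpredZ (rpred1 _).
apply: nfM; first exact: (polyOverP (Pk u)).
by apply: nf_mul_monomial => //; apply: rpredZ.
Qed.

(** The elements whose multiples of normal forms are again normal forms are a
    subalgebra; it contains the generators, and 1 is a normal form. *)
Lemma level_nf x : x \in level k.+1 -> nf x.
Proof.
pose S : {pred A} := fun x => asbool (forall z, nf z -> nf (x * z)).
have SC : GRing.subalg_closed S.
  split=> [|a u v /asboolP uS /asboolP vS|u v /asboolP uS /asboolP vS];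
    apply/asboolP => z zk.
  - by rewrite mul1r.
  - rewrite mulrDl -scalerAl -mulr_algl; apply: nfD; last exact: vS.
    by apply: nfM; [exact: rpredZ (rpred1 _) | exact: uS].
  - by rewrite -mulrA; apply/uS/vS.
have gS g : (exists2 v, v \in flag k.+1 & g = y v) -> g \in S.
  by case=> v vk ->; apply/asboolP => z; apply: nf_mul_gen.
move=> /(gen_subalg_min SC gS) /asboolP /(_ 1); rewrite mulr1; apply.
rewrite -[1]mul1r -(expr0 (yk 0)).
by apply: nf_monomial; rewrite ?rpred1 ?rpred0.
Qed.

(** The induction hypothesis is used twice: coefficients of positive degree
    are zero because their images vanish by independence of partial fractions,
    and what remains is an element of Q_k with image 0. *)
Lemma level_inj_step : {in level k, forall x, psi x = 0 -> x = 0} ->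
  {in level k.+1, forall x, psi x = 0 -> x = 0}.
Proof.
move=> IH x /level_nf [P Pk xE] psi_x0.
have [L [h [Phi [h_inj PhiX PhiV PhiF]]]] := generic_var_lift k.
(* hC embeds K_V as the constants of K_V(T), and Phi agrees with it on the
   image of Q_k, which does not involve the k-th variable *)
pose hC : {rmorphism symfrac V -> L} := h \o polyC.
have PhiE : {in level k, forall a, Phi (psi a) = hC (psi a)}.
  have psiC (c : F) : psi c%:A = c%:A by exact: rmorph_alg.
  apply: gen_subalg_equalizer => [c|_ [v vk ->]].
    have PhiC : Phi c%:A = hC c%:A by exact: PhiF.
    apply: etrans (congr1 Phi (psiC c)) _.
    apply: etrans PhiC _.
    exact: esym (congr1 hC (psiC c)).
  have eqv : Phi (linform v) = hC (linform v) by apply/PhiV/flag_coord.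
  apply: etrans (congr1 Phi (psi_y v)) _.
  apply: etrans (esym (congr1 hC (psi_y v))).
  by rewrite !fmorphV eqv.
have psi_yk u : psi (yk u) = (linform (e k) + linform u)^-1.
  by rewrite psi_y linearD.
have PC (u : V) : u \in flag k -> P u = ((P u)`_0)%:P.
  move=> uk; apply/polyP => i; rewrite coefC; case: eqP => [->//|/eqP i0].
  apply: IH; first exact: (polyOverP (Pk u)).
  rewrite xE in psi_x0; rewrite -lt0n in i0.
  apply: (@partial_fractions_coef0 A (symfrac V) L psi h Phi
    (finvect_type V) (fun v => (v : V) \in flag k) (linform (e k))
    (@linform F V) (fun v => yk v) P h_inj (@linform_inj F V) PhiX
    (fun v vk => PhiV v (flag_coord vk)) (fun v _ => psi_yk v)
    (fun v j _ => PhiE _ (polyOverP (Pk v) j)) psi_x0 u i uk i0).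
apply: (IH x) psi_x0; rewrite xE; apply: rpred_sum => u uk.
by rewrite PC // hornerC; apply: (polyOverP (Pk u)).
Qed.
End Level.

Lemma level_inj k : (k <= n)%N -> {in level k, forall x, psi x = 0 -> x = 0}.
Proof.
elim: k => [_|k IH kn]; last first.
  exact: (@level_inj_step (Ordinal kn) (IH (ltnW kn))).
pose S : {pred A} := fun x => asbool (exists c : F, x = c%:A).
have SC : GRing.subalg_closed S.
  split=> [|a u v /asboolP[c ->] /asboolP[d ->]
    |u v /asboolP[c ->] /asboolP[d ->]]; apply/asboolP.
  - by exists 1; rewrite scale1r.
  - by exists (a * c + d); rewrite scalerDl scalerA.
  - by exists (c * d); rewrite -scalerAl mul1r scalerA.
have gS g : (exists2 v, v \in flag 0 & g = y v) -> g \in S.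
  case=> v /flag0 -> ->; apply/asboolP; exists 0.
  by rewrite -(scale0r (0 : V)) yZ invr0 !scale0r.
move=> x /(gen_subalg_min SC gS) /asboolP[c ->].
rewrite linearZ /= rmorph1 => /eqP; rewrite scaler_eq0 oner_eq0 orbF => /eqP ->.
by rewrite scale0r.
Qed.
End NormalForm.

(** * The quotient algebra *)

Section Quotient.
Context (F : finFieldType) (V : vectType F).
Local Notation A := (quotalg (Yideal V)).

(** y_v in the introduction; the value 0 at v = 0 makes the relations of
    degree 1 hold for all scalars and all vectors. *)
Definition Yclass (v : V) : A :=
  if insub v is Some w then quotpi (Yideal V) (Y (w : nzvec V)) else 0.

Lemma Yclass_val (w : nzvec V) : Yclass (val w) = quotpi (Yideal V) (Y w).
Proof. by rewrite /Yclass valK. Qed.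

Lemma Yclass0 : Yclass 0 = 0.
Proof. by rewrite /Yclass insubF // eqxx. Qed.

Lemma nzvecP (v : V) : v != 0 -> {w : nzvec V | val w = v}.
Proof. by move=> v0; exists (Sub v v0); rewrite SubK. Qed.

Lemma quotpi_rel p : Yrel p -> quotpi (Yideal V) p = 0.
Proof.
by move=> p_rel; apply/eqP; rewrite quotpi_eq0; apply: mem_gen_ideal.
Qed.

Lemma YclassZ a v : Yclass (a *: v) = a^-1 *: Yclass v.
Proof.
have [->|a0] := eqVneq a 0; first by rewrite invr0 !scale0r Yclass0.
have [->|v0] := eqVneq v 0; first by rewrite scaler0 Yclass0 scaler0.
have av0 : a *: v != 0 by rewrite scaler_eq0 negb_or a0.
have [w wE] := nzvecP v0; have [aw awE] := nzvecP av0.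
rewrite -awE -wE !Yclass_val; apply/eqP; rewrite -subr_eq0 -linearZ -rmorphB /=.
by apply/eqP/quotpi_rel/Yrel_scale; rewrite // awE wE.
Qed.

Lemma YclassM v w : v != 0 -> w != 0 -> v + w != 0 ->
  Yclass v * Yclass w = Yclass (v + w) * (Yclass v + Yclass w).
Proof.
move=> /nzvecP[v' <-] /nzvecP[w' <-] /nzvecP[vw vwE].
rewrite -vwE !Yclass_val; apply/eqP.
rewrite -subr_eq0 -rmorphD -!rmorphM -rmorphB /=.
by apply/eqP/quotpi_rel/Yrel_add.
Qed.

Definition Ymap_val : A -> symfrac V := (val : invalg V -> symfrac V) \o Ymap V.
HB.instance Definition _ :=
  GRing.RMorphism.copy Ymap_val ((val : invalg V -> symfrac V) \o Ymap V).
Fact Ymap_val_is_scalable : scalable Ymap_val.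
Proof. by move=> a x; rewrite /Ymap_val /= !linearZ. Qed.
HB.instance Definition _ :=
  GRing.isScalable.Build F A (symfrac V) _ Ymap_val Ymap_val_is_scalable.

Lemma Ymap_val_class v : Ymap_val (Yclass v) = (linform v)^-1.
Proof.
have [->|v0] := eqVneq v 0; first by rewrite Yclass0 !linear0 invr0.
by have [w <-] := nzvecP v0; rewrite Yclass_val /Ymap_val /= Ymap_Y.
Qed.

Lemma level_full x : x \in level Yclass (\dim {:V}).
Proof.
have [p ->] := quotpi_surj x.
pose S : {pred Yalg V} :=
  fun p => quotpi (Yideal V) p \in level Yclass (\dim {:V}).
have SE q : (q \in S) = (quotpi (Yideal V) q \in level Yclass (\dim {:V})).
  by [].
have SC : GRing.subalg_closed S.
  split=> [|a u v|u v]; rewrite !SE.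
  - by rewrite rmorph1 rpred1.
  - by rewrite linearP => uS vS; rewrite rpredD ?rpredZ.
  - by rewrite rmorphM => uS vS; rewrite rpredM.
have SY w : polyvar F w \in S.
  by rewrite SE -/(Y w) -Yclass_val; apply/y_level/flag_full.
exact: polyalg_gen SC SY p.
Qed.

Lemma Ymap_inj : injective (Ymap V).
Proof.
move=> a b ab; apply/eqP; rewrite -subr_eq0; apply/eqP.
apply: (level_inj YclassZ YclassM Ymap_val_class (leqnn _)).
  exact: level_full.
have eq_ab : Ymap_val a = Ymap_val b by apply: (congr1 val ab).
by rewrite rmorphB /= eq_ab subrr.
Qed.

Lemma Ymap_surj b : exists a, Ymap V a = b.
Proof.
pose S : {pred symfrac V} := fun x => asbool (exists a, val (Ymap V a) = x).
have : val b \in S.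
  apply: (gen_subalg_min (S := S)) (valP b) => [|_ [w ->]]; last first.
    by apply/asboolP; exists (quotpi (Yideal V) (Y w)); rewrite Ymap_Y.
  split=> [|a u v|u v]; first by apply/asboolP; exists 1; rewrite !rmorph1.
  - move=> /asboolP[c <-] /asboolP[d <-]; apply/asboolP.
    by exists (a *: c + d); rewrite !linearP.
  - move=> /asboolP[c <-] /asboolP[d <-]; apply/asboolP.
    by exists (c * d); rewrite !rmorphM.
by move=> /asboolP[a aE]; exists a; apply: val_inj.
Qed.
End Quotient.

Theorem theorem1p6 (F : finFieldType) (V : vectType F) :
  {:V}%VS != 0%VS ->
  bijective (Ymap V : {lrmorphism quotalg (Yideal V) -> invalg V}).
Proof.
move=> _; have /boolp.choice [g gK] := @Ymap_surj F V.
by exists g => // a; apply: Ymap_inj; rewrite gK.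
Qed.
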